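(* Let $G=(V,E)$ be a locally finite, connected, infinite graph. Then for every $p<1$ there exists a general bond percolation $\mathbf{P}$ on $G$, with configuration denoted $\omega$, such that $\mathbf{P}[e\in\omega]>p$ for every $e\in E$, which satisfies the FKG-inequality and has connectivity decay, i.e. $$\inf_{u,v\in V}\ \mathbf{P}[u\leftrightarrow v]=0 .$$
   Context: Graphs have a vertex set $V$ and a set $E$ of undirected edges. A graph is locally finite if every vertex has finite degree. A general bond percolation on $G$ is a probability measure $\mathbf{P}$ on subsets of $E$, i.e. on $\{0,1\}^E$ with its Borel $\sigma$-algebra. The configuration $\omega\subset E$ is identified with the induced subgraph with vertex set $V$ and edge set $\omega$; its connected components are called clusters, and $\{u\leftrightarrow v\}$ is the event that $u$ and $v$ lie in the same cluster of $\omega$. A Borel event $A\subset\{0,1\}^E$ is increasing if $\omega\in A$ and $\omega\le\omega'$ (coordinatewise) imply $\omega'\in A$. $\mathbf{P}$ satisfies the FKG-inequality if $\mathbf{P}(A\cap B)\ge\mathbf{P}(A)\mathbf{P}(B)$ for any two increasing events $A,B$. *)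

(* Defs.v *)
From Stdlib Require Import Relation_Operators.
From HB Require Import structures.
From mathcomp Require Import all_boot all_order all_algebra.
From mathcomp Require Import all_classical all_reals all_analysis.

Set Implicit Arguments.
Unset Strict Implicit.
Unset Printing Implicit Defensive.

Import Order.TTheory GRing.Theory Num.Theory.
Local Open Scope classical_set_scope.
Local Open Scope ring_scope.
Local Open Scope ereal_scope.

(* Edges form a type of their own, with unordered endpoints. Simple graphs are
   the graphs whose [ends] is injective with values of two elements; parallel
   edges and loops are not excluded. *)
Record graph := Graph {
  vertex : choiceType ;
  edge : choiceType ;
  ends : edge -> set vertex ;
  endsP : forall e, exists u v, ends e = [set u; v] }.

Definition locally_finite (G : graph) : Prop :=
  forall v : vertex G, finite_set [set e | ends e v].

(* {0,1}^E with the Borel sigma-algebra of the product topology, [bool] being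
   discrete. *)
Definition config (G : graph) :=
  g_sigma_algebraType (@open {ptws edge G -> bool}).

Definition open_adjacent (G : graph) (w : config G) (u v : vertex G) : Prop :=
  exists2 e : edge G, w e & ends e = [set u; v].

Definition open_cluster (G : graph) (w : config G) (u : vertex G) :
    set (vertex G) :=
  [set v | clos_refl_trans _ (open_adjacent w) u v].

Definition connected_graph (G : graph) : Prop :=
  forall u v : vertex G, open_cluster (fun=> true : bool) u v.

Definition increasing (G : graph) (A : set (config G)) : Prop :=
  forall w w' : config G, A w -> (forall e, (w e <= w' e)%O) -> A w'.

Definition FKG (G : graph) (R : realType) (P : probability (config G) R) :
    Prop :=
  forall A B : set (config G), measurable A -> measurable B ->
    increasing A -> increasing B -> P A * P B <= P (A `&` B).

Definition connectivity_decay (G : graph) (R : realType)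
    (P : probability (config G) R) : Prop :=
  ereal_inf [set x | exists u v : vertex G, x = P [set w | open_cluster w u v]] = 0.

(* Main.v *)
Require Import Defs.
From HB Require Import structures.
From mathcomp Require Import all_boot all_order all_algebra.
From mathcomp Require Import all_classical all_reals all_analysis.
From mathcomp Require Import measurable_realfun ring lra.

(** Fix a root [o] and let [vball o n] be the ball of radius [n] around it. An
    edge can leave at most one of these balls. Independently for each [n], all
    the edges that leave the ball of radius [n] are closed together with
    probability [1/b], and are open together otherwise; every edge that leaves
    no ball is open. Then

    - each edge is open with probability at least [1 - 1/b], which exceeds [p]
      when [b] is large;
    - the configuration is an increasing function of independent bits, so that
      the FKG inequality is an instance of Harris's inequality;
    - a vertex outside the ball of radius [n] is connected to [o] only if none
      of the first [n] layers is closed, which has probability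
      [(1 - 1/b) ^ n]. As balls are finite and the graph is infinite, there are
      such vertices for each [n].

    The independent bits are read off a uniform point of [0, 1[: the [n]-th bit
    says whether the [n]-th digit in base [b] is nonzero. The law of the
    percolation is the image of Lebesgue measure, and no measure on an infinite
    product has to be constructed ([measurable_digit_config]).

    Harris's inequality for infinitely many digits ([digit_increasing_fkg]) goes
    as follows. Let F_n be the sigma-algebra of the first [n] digits, whose
    atoms are intervals, and consider
    [mean_cond_prod A B n] = E[P(A | F_n) P(B | F_n)]. For [n = 0] this is
    P(A) P(B). It is nondecreasing in [n], since raising a digit is a
    translation that maps an atom to another one, hence, for increasing
    events, the conditional probability given the next digit is monotone in
    that digit, and Chebyshev's sum inequality applies
    ([mean_cond_prod_nondecreasing]). Its limit is at most P(A /\ B): inner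
    regularity gives disjoint compact sets inside [A] and inside its complement
    that together have almost full measure, and short intervals do not meet both
    ([mean_cond_prod_le]). This last step replaces martingale convergence. *)

Set Implicit Arguments.
Unset Strict Implicit.
Unset Printing Implicit Defensive.

Import Order.TTheory GRing.Theory Num.Theory.
Import numFieldNormedType.Exports.

Local Open Scope classical_set_scope.
Local Open Scope ring_scope.

(** * The uniform law on the unit interval *)

Lemma measurable_shift (R : realType) (t : R) :
  measurable_fun setT (fun x : measurableTypeR R => x - t : measurableTypeR R).
Proof. by apply: measurable_funB => //; exact: measurable_id. Qed.

Lemma lebesgue_measure_shift (R : realType) (t : R) (A : set R) :
  measurable A -> lebesgue_measure [set x | A (x - t)] = lebesgue_measure A.
Proof.
move=> mA; pose f : measurableTypeR R -> measurableTypeR R := fun x => x - t.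
have mf : measurable_fun setT f by exact: measurable_shift.
change (pushforward lebesgue_measure f A = lebesgue_measure A).
apply/esym/(@lebesgue_measure_unique _ (pushforward lebesgue_measure f)) => //.
move=> _ [[a c]] _ <- /=.
rewrite /pushforward /= (_ : f @^-1` _ = `]a + t, c + t]%classic); last first.
  by apply/seteqP; split=> x /=; rewrite !in_itv/= ltrBrDr lerBlDr.
rewrite !lebesgue_measure_itv/= !lte_fin ltrD2r.
by rewrite -!EFinD (addrC c t) (addrC a) opprD addrACA subrr add0r.
Qed.

Section unit_lebesgue.
Context (R : realType).
Local Open Scope ereal_scope.

Definition unit_lebesgue : set (measurableTypeR R) -> \bar R :=
  mrestr lebesgue_measure (measurable_itv (`[0%R, 1%R[ : interval R)).

HB.instance Definition _ := Measure.on unit_lebesgue.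

Lemma unit_lebesgue_setT : unit_lebesgue setT = 1.
Proof.
by rewrite /unit_lebesgue /mrestr setTI lebesgue_measure_itv/= lte01 oppr0 adde0.
Qed.

HB.instance Definition _ :=
  Measure_isProbability.Build _ _ R unit_lebesgue unit_lebesgue_setT.

End unit_lebesgue.

(** Real values, rather than extended ones, so that products and differences of
    probabilities can be handled in a field. *)
Definition pr (R : realType) (A : set (measurableTypeR R)) : R :=
  fine (unit_lebesgue A).

Section probability.
Context (R : realType).
Implicit Types A B : set (measurableTypeR R).

Lemma prE A : measurable A -> unit_lebesgue A = (pr A)%:E.
Proof. by move=> mA; rewrite fineK// fin_num_measure. Qed.

Lemma pr_ge0 A : 0 <= pr A.
Proof. by rewrite fine_ge0. Qed.

Lemma le_pr A B : measurable A -> measurable B ->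
  A `&` `[0, 1[ `<=` B -> pr A <= pr B.
Proof.
move=> mA mB AB; rewrite -lee_fin -!prE// /unit_lebesgue /mrestr.
apply: le_measure; rewrite ?inE; try exact: measurableI.
by move=> x [Ax x01]; split=> //; apply: AB.
Qed.

Lemma eq_pr A B : measurable A -> measurable B ->
  A `&` `[0, 1[ = B `&` `[0, 1[ -> pr A = pr B.
Proof. by move=> mA mB AB; rewrite /pr /unit_lebesgue /mrestr AB. Qed.

Lemma prU A B : measurable A -> measurable B -> A `&` B = set0 ->
  pr (A `|` B) = pr A + pr B.
Proof.
move=> mA mB AB; apply: EFin_inj; rewrite EFinD -!prE//; last exact: measurableU.
exact: measureU.
Qed.

Lemma pr_setT : pr [set: measurableTypeR R] = 1.
Proof. by rewrite /pr probability_setT. Qed.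

Lemma pr_leU A B : measurable A -> measurable B ->
  pr (A `|` B) <= pr A + pr B.
Proof.
move=> mA mB; rewrite -lee_fin EFinD -!prE//; last exact: measurableU.
exact: measureU2.
Qed.

Lemma pr_itv (a c : R) : 0 <= a -> a <= c -> c <= 1 -> pr `[a, c[ = c - a.
Proof.
move=> a0 ac c1; rewrite /pr /unit_lebesgue /mrestr setIidl.
  rewrite lebesgue_measure_itv/= lte_fin; case: ltP => // ca.
  by rewrite (@le_anti _ _ a c) ?ac// subrr.
move=> x /=; rewrite !in_itv/= => /andP[ax xc].
by rewrite (le_trans a0)//= (lt_le_trans xc).
Qed.

Lemma pr_partition (a h : R) (N : nat) A : 0 <= h -> measurable A ->
  pr (A `&` `[a, a + N%:R * h[) =
  \sum_(0 <= i < N) pr (A `&` `[a + i%:R * h, a + i.+1%:R * h[).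
Proof.
move=> h0 mA; elim: N => [|N IHN].
  by rewrite big_nil mul0r addr0 set_itvco0 setI0 /pr measure0.
rewrite big_nat_recr//= -IHN -prU; try exact: measurableI.
  congr pr; rewrite -setIUr; congr (A `&` _); apply/seteqP.
  have ? : a <= a + N%:R * h by rewrite lerDl mulr_ge0.
  have ? : a + N%:R * h <= a + N.+1%:R * h by rewrite lerD2l ler_wpM2r// ler_nat.
  split=> x /=; rewrite !in_itv/=.
    by case/andP=> ax xN; rewrite ax xN/= andbT; case: ltP; [left|right].
  by case=> /andP[? ?]; apply/andP; split; lra.
rewrite setIACA setIid; apply/seteqP; split=> // x [_ []] /=; rewrite !in_itv/=.
by move=> /andP[_ /lt_le_trans x1] /andP[/x1]; rewrite ltxx.
Qed.

(** The form in which translation invariance is used: injecting one event into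
    another by a translation compares their probabilities. *)
Lemma pr_shift (t : R) A B : measurable A -> measurable B ->
  A `<=` `[0, 1[ -> (forall x, A x -> B (x + t) /\ (x + t) \in `[0, 1[) ->
  pr A <= pr B.
Proof.
move=> mA mB A01 AB; rewrite -lee_fin -!prE// /unit_lebesgue /mrestr setIidl//.
rewrite -(lebesgue_measure_shift t)//; apply: le_measure; rewrite ?inE.
- suff : measurable (setT `&` (fun x : measurableTypeR R => x - t) @^-1` A).
    by rewrite setTI.
  exact: measurable_shift.
- exact: measurableI.
- by move=> x /= /AB; rewrite subrK.
Qed.

End probability.

(** * Digits of a real number in base b *)

Lemma sum_blocks (V : nmodType) (N b : nat) (F : nat -> V) :
  \sum_(0 <= k < N * b) F k =
  \sum_(0 <= j < N) \sum_(0 <= i < b) F (j * b + i)%N.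
Proof.
rewrite big_nat_mul; apply: eq_bigr => j _.
rewrite -{1}[(j * b)%N]add0n big_addn mulSn addnK.
by apply: eq_bigr => i _; rewrite addnC.
Qed.

(** Chebyshev's sum inequality. The difference of the two sides grows at each
    step by the sum of the products [(f N - f i) * (g N - g i)]. *)
Lemma chebyshev_sum (R : realDomainType) (N : nat) (f g : nat -> R) :
  (forall i j, (i <= j < N)%N -> f i <= f j) ->
  (forall i j, (i <= j < N)%N -> g i <= g j) ->
  (\sum_(0 <= i < N) f i) * (\sum_(0 <= i < N) g i) <=
  N%:R * \sum_(0 <= i < N) f i * g i.
Proof.
elim: N => [|N IHN] fle gle; first by rewrite !big_nil mul0r.
have {}IHN : (\sum_(0 <= i < N) f i) * (\sum_(0 <= i < N) g i) <=
    N%:R * \sum_(0 <= i < N) f i * g i.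
  by apply: IHN => i j /andP[ij jN]; [apply: fle|apply: gle]; rewrite ij ltnW.
have : 0 <= \sum_(0 <= i < N) (f N - f i) * (g N - g i).
  rewrite big_nat; apply: sumr_ge0 => i /= iN.
  by rewrite mulr_ge0// subr_ge0; [apply: fle|apply: gle]; rewrite ltnSn (ltnW iN).
under eq_bigr do rewrite mulrBl !mulrBr.
rewrite !sumrB -!mulr_sumr -mulr_suml sumr_const_nat subn0 -[_ *+ N]mulr_natl.
rewrite !big_nat_recr//= -natr1; move: IHN; lra.
Qed.

Section digits.
Context (R : realType) (b : nat).
Hypothesis b_gt1 : (1 < b)%N.
Implicit Types (x y : R) (A B : set (measurableTypeR R)).

(** The first [n] digits of [x], read as an integer in base [b]. *)
Definition digit_prefix n x : nat := Num.truncn (b%:R ^+ n * x).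
Definition digit n x : nat := (digit_prefix n.+1 x %% b)%N.
Definition digit_cell n j : set (measurableTypeR R) :=
  `[j%:R / b%:R ^+ n, j.+1%:R / b%:R ^+ n[%classic.

Let bX_gt0 n : 0 < b%:R ^+ n :> R.
Proof. by rewrite exprn_gt0// ltr0n (ltn_trans _ b_gt1). Qed.

Let bX_neq0 n : b%:R ^+ n != 0 :> R. Proof. by rewrite gt_eqF. Qed.

Lemma measurable_digit_cell n j : measurable (digit_cell n j).
Proof. exact: measurable_itv. Qed.
#[local] Hint Resolve measurable_digit_cell : core.

Lemma digit_cellP n j x : 0 <= x -> digit_cell n j x <-> digit_prefix n x = j.
Proof.
move=> x0; rewrite /digit_cell/= in_itv/= ler_pdivrMr// ltr_pdivlMr// mulrC.
have bx0 : 0 <= b%:R ^+ n * x by rewrite mulr_ge0// ltW.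
by rewrite -truncn_eq//; split=> /eqP.
Qed.

Lemma cell_ge0 n j x : digit_cell n j x -> 0 <= x.
Proof.
by rewrite /digit_cell/= in_itv/= => /andP[+ _]; apply: le_trans;
  rewrite divr_ge0// ltW.
Qed.

Lemma cell01 n j : (j < b ^ n)%N -> digit_cell n j `<=` `[0, 1[.
Proof.
move=> jb x cx; rewrite /= in_itv/= (cell_ge0 cx)/=.
move: cx; rewrite /digit_cell/= in_itv/= => /andP[_ /lt_le_trans]; apply.
by rewrite ler_pdivrMr// mul1r -natrX ler_nat.
Qed.

(** Forgetting the last [m] of [n + m] digits is an integer division; negative
    numbers are covered because all their prefixes are [0]. *)
Lemma digit_prefix_div n m x :
  digit_prefix n x = (digit_prefix (n + m) x %/ b ^ m)%N.
Proof.
have [x0|x0] := leP 0 x; last first.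
  have prefix0 k : digit_prefix k x = 0%N.
    apply/eqP; rewrite -leqn0 truncn_le_nat (lt_trans _ ltr01)//.
    by rewrite pmulr_rlt0.
  by rewrite !prefix0 div0n.
set k := digit_prefix (n + m) x.
have bm : (0 < b ^ m)%N by rewrite expn_gt0 (ltn_trans _ b_gt1).
have : digit_cell (n + m) k x by apply/digit_cellP.
rewrite /digit_cell/= in_itv/= ler_pdivrMr// ltr_pdivlMr// exprD => /andP[k1 k2].
apply/eqP; rewrite /digit_prefix truncn_eq; last by rewrite mulr_ge0// ltW.
apply/andP; split.
  rewrite -(ler_pM2r (bX_gt0 m)) -[X in _ * X <= _]natrX -natrM.
  rewrite (le_trans _ (_ : k%:R <= _))// ?ler_nat ?leq_divM//.
  by rewrite mulrAC mulrC.
rewrite -(ltr_pM2r (bX_gt0 m)) -[X in _ < _ * X]natrX -natrM.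
rewrite (lt_le_trans (_ : _ < k.+1%:R))// ?ler_nat ?ltn_ceil//.
by rewrite mulrAC mulrC.
Qed.

Lemma pr_cell n j : (j < b ^ n)%N -> pr (digit_cell n j) = (b%:R ^+ n)^-1.
Proof.
move=> jb; rewrite pr_itv.
- by rewrite -mulrBl -natrB// subSn// subnn mul1r.
- by rewrite divr_ge0// ltW.
- by rewrite ler_wpM2r ?invr_ge0 ?ltW// ltr_nat.
- by rewrite ler_pdivrMr// mul1r -natrX ler_nat.
Qed.

Lemma pr_cells n A : measurable A ->
  pr A = \sum_(0 <= j < b ^ n) pr (A `&` digit_cell n j).
Proof.
move=> mA; have h0 : 0 <= (b%:R ^+ n)^-1 :> R by rewrite invr_ge0 ltW.
have := pr_partition 0 (b ^ n) h0 mA.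
rewrite add0r natrX divff// => e.
transitivity (pr (A `&` `[0, 1[)).
  by apply: eq_pr; rewrite ?setIA -?setIA ?setIid//; exact: measurableI.
by rewrite e; apply: eq_bigr => i _; rewrite !add0r.
Qed.

Lemma pr_cell_split n j A : measurable A ->
  pr (A `&` digit_cell n j) =
  \sum_(0 <= i < b) pr (A `&` digit_cell n.+1 (j * b + i)%N).
Proof.
move=> mA; have h0 : 0 <= (b%:R ^+ n.+1)^-1 :> R by rewrite invr_ge0 ltW.
have b0 : b%:R != 0 :> R by rewrite pnatr_eq0 -lt0n (ltn_trans _ b_gt1).
have := pr_partition (j%:R / b%:R ^+ n) b h0 mA.
have e i : j%:R / b%:R ^+ n + i%:R / b%:R ^+ n.+1 =
    (j * b + i)%N%:R / b%:R ^+ n.+1 :> R.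
  by rewrite natrD natrM exprS; field; rewrite bX_neq0.
have e1 : j%:R / b%:R ^+ n + b%:R / b%:R ^+ n.+1 = j.+1%:R / b%:R ^+ n :> R.
  by rewrite exprS -natr1; field; rewrite bX_neq0.
rewrite e1 => ->; apply: eq_bigr => i _.
by rewrite !e addnS.
Qed.

Definition digit_increasing A := forall x y, x \in `[0, 1[ -> y \in `[0, 1[ ->
  (forall m, (digit m x <= digit m y)%N) -> A x -> A y.

Lemma cell_child01 n j i : (j < b ^ n)%N -> (i < b)%N ->
  (j * b + i < b ^ n.+1)%N.
Proof.
move=> jn ib; rewrite expnSr (@leq_trans (j.+1 * b))//;
  last by rewrite leq_mul2r jn orbT.
by rewrite mulSn addnC ltn_add2r.
Qed.

(** Changing the digit of index [n] from [i] to [i'] is the translation by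
    [(i' - i) / b ^ n.+1]: it leaves the other digits unchanged, so that it
    preserves membership in an increasing event. *)
Lemma le_pr_cell n j i i' A : measurable A -> digit_increasing A ->
  (j < b ^ n)%N -> (i <= i' < b)%N ->
  pr (A `&` digit_cell n.+1 (j * b + i)%N) <=
  pr (A `&` digit_cell n.+1 (j * b + i')%N).
Proof.
move=> mA incA jn /andP[ii' i'b]; have ib := leq_ltn_trans ii' i'b.
pose d := (i' - i)%N; pose t : R := d%:R / b%:R ^+ n.+1.
apply: (@pr_shift _ t); [exact: measurableI|exact: measurableI| |].
  by move=> x [_]; apply: cell01; exact: cell_child01.
move=> x [Ax cx]; have x0 := cell_ge0 cx.
have t0 : 0 <= t by rewrite divr_ge0// ltW.
have y0 : 0 <= x + t by rewrite addr_ge0.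
(* The added integer is a multiple of [b] when [0 < m], which keeps the later
   digits. *)
have shift m :
    digit_prefix (n.+1 + m) (x + t) = (digit_prefix (n.+1 + m) x + d * b ^ m)%N.
  rewrite /digit_prefix mulrDr (_ : b%:R ^+ (n.+1 + m) * t = (d * b ^ m)%N%:R).
    rewrite addrC truncnD ?natr_nat ?qualifE/= ?mulr_ge0// ?ltW//.
    by rewrite natrK addnC.
  by rewrite natrM natrX /t exprD; field; rewrite bX_neq0.
have /(digit_cellP _ _ x0) px := cx.
have py : digit_prefix n.+1 (x + t) = (j * b + i')%N.
  by have := shift 0; rewrite !addn0 muln1 => ->; rewrite px -addnA subnKC.
have cy : digit_cell n.+1 (j * b + i')%N (x + t) by apply/digit_cellP.
have y01 : x + t \in `[0, 1[ by apply: (cell01 _ cy); exact: cell_child01.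
split=> //; split=> //; apply: (incA x) => //.
  by apply: (cell01 _ cx); exact: cell_child01.
have prefixn z k : (k < b)%N -> digit_prefix n.+1 z = (j * b + k)%N ->
    digit_prefix n z = j.
  move=> kb pz; rewrite (digit_prefix_div n 1) addn1 pz expn1 divnMDl.
    by rewrite divn_small// addn0.
  exact: ltn_trans b_gt1.
move=> m; rewrite /digit; case: (ltngtP m n) => [mn|nm|->].
- have mn1 : (m.+1 <= n)%N := mn.
  have e z : digit_prefix m.+1 z = _ := @digit_prefix_div m.+1 (n - m.+1) z.
  by rewrite !e// !subnKC// (prefixn _ i)// (prefixn _ i').
- have -> : m.+1 = (n.+1 + (m - n).-1.+1)%N.
    by rewrite prednK ?subn_gt0// addSn subnKC// ltnW.
  by rewrite shift [(digit_prefix _ _ + d * _)%N]addnC expnSr mulnA modnMDl.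
- by rewrite px py !modnMDl !modn_small.
Qed.

(** The mean of the product of the conditional probabilities of [A] and [B] given
    the first [n] digits. *)
Definition mean_cond_prod A B n : R :=
  b%:R ^+ n *
  \sum_(0 <= j < b ^ n) pr (A `&` digit_cell n j) * pr (B `&` digit_cell n j).

Lemma mean_cond_prod0 A B : measurable A -> measurable B ->
  mean_cond_prod A B 0 = pr A * pr B.
Proof.
move=> mA mB; rewrite /mean_cond_prod expr0 mul1r big_nat1.
by rewrite (pr_cells 0 mA) (pr_cells 0 mB) !big_nat1.
Qed.

(** One step of Harris's inequality: on each cell, the conditional probabilities
    given one more digit are nondecreasing in this digit. *)
Lemma mean_cond_prod_nondecreasing A B : measurable A -> measurable B ->
  digit_increasing A -> digit_increasing B ->
  nondecreasing_seq (mean_cond_prod A B).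
Proof.
move=> mA mB incA incB; apply/nondecreasing_seqP => n.
rewrite /mean_cond_prod expnSr sum_blocks exprSr -mulrA ler_pM2l// mulr_sumr.
rewrite big_nat [leRHS]big_nat; apply: ler_sum => j /= jn.
rewrite !(pr_cell_split _ _ mA) !(pr_cell_split _ _ mB).
by apply: chebyshev_sum => i i' ii'; apply: le_pr_cell.
Qed.

End digits.

(** * Harris's inequality for infinitely many digits *)

Lemma compact_separation (R : realType) (K L : set R) :
  compact K -> compact L -> K `&` L = set0 ->
  exists2 d : R, 0 < d & forall x y, K x -> L y -> d <= `|x - y|.
Proof.
move=> cK cL KL; pose f (z : R * R) := `|z.1 - z.2|.
have cf : continuous f.
  move=> z; apply: cvg_norm; apply: cvgB; [exact: cvg_fst|exact: cvg_snd].
have cfKL : compact (f @` (K `*` L)).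
  apply: continuous_compact; last exact: compact_setX.
  exact: continuous_subspaceT.
have f0 : (~` (f @` (K `*` L))) 0.
  move=> [[x y] [/= Kx Ly] /eqP]; rewrite /f /= normr_eq0 subr_eq0 => /eqP xy.
  have : (K `&` L) x by split=> //; rewrite xy.
  by rewrite KL.
have /closed_openC of0 := compact_closed (@Rhausdorff R) cfKL.
have /nbhs_ballP[d /= d0 fd] := open_nbhs_nbhs (conj of0 f0).
exists d => // x y Kx Ly; rewrite leNgt; apply/negP => xyd.
apply: (fd (f (x, y))); last by exists (x, y).
by rewrite /ball/= sub0r normrN normr_id.
Qed.

Lemma pr_inner_compact (R : realType) (A : set (measurableTypeR R)) (e : R) :
  measurable A -> 0 < e ->
  exists K : set R, [/\ compact K, K `<=` A & pr (A `\` K) < e].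
Proof.
move=> mA e0; have mI : measurable (`[0, 1[%classic : set R) by exact: measurable_itv.
have mAI : measurable (A `&` `[0, 1[) by exact: measurableI.
have fin : (lebesgue_measure (A `&` `[0%R, 1%R[) < +oo)%E.
  rewrite (@le_lt_trans _ _ (lebesgue_measure (`[0%R, 1%R[%classic : set R)))//.
    by apply: le_measure; rewrite ?inE.
  by rewrite lebesgue_measure_itv/= lte01 oppr0 adde0 ltry.
have [K [cK KA Ke]] := lebesgue_regularity_inner mAI fin e0.
have mK : measurable K by exact: compact_measurable.
exists K; split=> //; first by move=> x /KA[].
rewrite -lte_fin -prE; last exact: measurableD.
by rewrite /unit_lebesgue /mrestr setIDAC setIDA.
Qed.

Section fkg.
Context (R : realType) (b : nat).
Hypothesis b_gt1 : (1 < b)%N.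
Implicit Types (A B : set (measurableTypeR R)).

(** A cell of length less than [d] misses [K] or [L]. If it misses [K], bound its
    term by the probability of [A] on the cell; all of this event lies outside
    of [K] and [L]. If it misses [L], bound its term by the probability of [B] on
    the cell, where the part of [B] outside of [A] lies outside of [K] and
    [L]. *)
Lemma mean_cond_prod_le A B (K L : set R) (d : R) n :
  measurable A -> measurable B ->
  compact K -> compact L -> K `<=` A -> L `<=` ~` A ->
  (forall x y, K x -> L y -> d <= `|x - y|) -> (b%:R ^+ n)^-1 < d ->
  mean_cond_prod b A B n <= pr (A `&` B) + pr (~` (K `|` L)).
Proof.
move=> mA mB cK cL KA LA Kd nd.
have mK : measurable K by exact: compact_measurable.
have mL : measurable L by exact: compact_measurable.
have mAB : measurable (A `&` B) by exact: measurableI.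
have mE : measurable (~` (K `|` L)) by apply: measurableC; exact: measurableU.
have b0 : 0 < b%:R ^+ n :> R by rewrite exprn_gt0// ltr0n (ltn_trans _ b_gt1).
rewrite (pr_cells b_gt1 n mAB) (pr_cells b_gt1 n mE) -big_split/= /mean_cond_prod.
rewrite mulr_sumr [leLHS]big_nat [leRHS]big_nat; apply: ler_sum => j /= jn.
set c : set (measurableTypeR R) := digit_cell b n j.
have mc : measurable c by exact: measurable_digit_cell.
have le_cell X : measurable X -> b%:R ^+ n * pr (X `&` c) <= 1.
  move=> mX; rewrite mulrC -ler_pdivlMr// mul1r -(pr_cell R b_gt1 jn).
  by apply: le_pr => //; [exact: measurableI|move=> x [[]]].
have [Kc|Kc] := pselect (K `&` c = set0).
  apply: (@le_trans _ _ (pr (A `&` c))).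
    by rewrite mulrCA ler_piMr ?pr_ge0// le_cell.
  apply: (@le_trans _ _ (pr (~` (K `|` L) `&` c))); last by rewrite lerDr pr_ge0.
  apply: le_pr; try exact: measurableI.
  move=> x [[Ax cx] _]; split=> // -[Kx|/LA//].
  by have : (K `&` c) x by []; rewrite Kc.
have Lc : L `&` c = set0.
  rewrite -subset0 => y [Ly cy]; apply: Kc; rewrite -subset0 => x [Kx cx].
  have := Kd _ _ Kx Ly; rewrite leNgt => /negP; apply.
  apply: le_lt_trans nd.
  move: cx cy; rewrite /c /digit_cell /= !in_itv/= -natr1 mulrDl mul1r.
  by move=> /andP[? ?] /andP[? ?]; rewrite ler_norml; apply/andP; split; lra.
apply: (@le_trans _ _ (pr (B `&` c))).
  by rewrite mulrA ler_piMl ?pr_ge0// le_cell.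
apply: le_trans (pr_leU _ _); try exact: measurableI.
apply: le_pr; try (by do ?[exact: measurableI|apply: measurableU]).
move=> x [[Bx cx] _]; have [Ax|Ax] := pselect (A x); first by left.
right; split=> // -[/KA//|Lx].
by have : (L `&` c) x by []; rewrite Lc.
Qed.

Lemma digit_increasing_fkg A B : measurable A -> measurable B ->
  digit_increasing b A -> digit_increasing b B ->
  pr A * pr B <= pr (A `&` B).
Proof.
move=> mA mB incA incB; apply/ler_addgt0Pr => e e0.
have e20 : 0 < e / 2 by rewrite divr_gt0.
have mAc : measurable (~` A) by exact: measurableC.
have [K [cK KA Ke]] := pr_inner_compact mA e20.
have [L [cL LA Le]] := pr_inner_compact mAc e20.
have mK : measurable K by exact: compact_measurable.
have mL : measurable L by exact: compact_measurable.
have KL : K `&` L = set0 by rewrite -subset0 => x [/KA Ax /LA].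
have [d d0 Kd] := compact_separation cK cL KL.
pose n := Num.truncn d^-1.
have nd : (b%:R ^+ n)^-1 < d.
  rewrite invf_plt ?posrE//; last by rewrite exprn_gt0// ltr0n (ltn_trans _ b_gt1).
  by rewrite (lt_le_trans (truncnS_gt _))// -natrX ler_nat ltn_expl.
rewrite -(mean_cond_prod0 b_gt1 mA mB).
apply: le_trans (mean_cond_prod_nondecreasing b_gt1 mA mB incA incB (leq0n n)) _.
apply: le_trans (mean_cond_prod_le mA mB cK cL KA LA Kd nd) _.
rewrite lerD2l [e]splitr; apply: le_trans (lerD (ltW Ke) (ltW Le)).
apply: le_trans (pr_leU _ _); try exact: measurableD.
apply: le_pr; first by apply: measurableC; exact: measurableU.
  by apply: measurableU; exact: measurableD.
move=> x [/not_orP[Kx Lx] _].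
by have [Ax|Ax] := pselect (A x); [left|right].
Qed.

End fkg.

(** * Independence of the nonzero digits *)

Section nonzero_digits.
Context (R : realType) (b : nat).
Hypothesis b_gt1 : (1 < b)%N.
Local Notation T := (measurableTypeR R).

Lemma measurable_digit_prefix n (P : set nat) :
  measurable [set x : T | P (digit_prefix b n x)].
Proof.
have bn0 : 0 < b%:R ^+ n :> R by rewrite exprn_gt0// ltr0n (ltn_trans _ b_gt1).
have mle k : measurable [set x : T | (digit_prefix b n x <= k)%N].
  rewrite (_ : [set x | _] = `]-oo, k.+1%:R / b%:R ^+ n[%classic).
    exact: measurable_itv.
  by apply/seteqP; split=> x /=; rewrite in_itv/= truncn_le_nat ltr_pdivlMr// mulrC.
have meq k : measurable [set x : T | digit_prefix b n x = k].
  case: k => [|k].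
    rewrite (_ : [set x | _] = [set x : T | (digit_prefix b n x <= 0)%N])//.
    by apply/seteqP; split=> x /=; rewrite leqn0 => /eqP.
  rewrite (_ : [set x | _] =
    [set x : T | (digit_prefix b n x <= k.+1)%N] `\`
    [set x : T | (digit_prefix b n x <= k)%N]).
    exact: measurableD.
  apply/seteqP; split=> x /= => [->|]; first by rewrite ltnn leqnn.
  by move=> [xk /negP]; rewrite -ltnNge => kx; apply/eqP; rewrite eqn_leq xk.
rewrite (_ : [set x | _] = \bigcup_(k in P) [set x : T | digit_prefix b n x = k]).
  by apply: bigcup_measurable => k _; exact: meq.
by apply/seteqP; split=> x /= => [Px|[k Pk /= ->]//]; exists (digit_prefix b n x).
Qed.

(** The digit of index [n] is independent of the digits before it, and vanishes
    with probability [1/b]. *)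
Lemma pr_nonzero_digit n (J : pred nat) :
  pr [set x : T | J (digit_prefix b n x) && (digit b n x != 0%N)] =
  (1 - b%:R^-1) * pr [set x : T | J (digit_prefix b n x)].
Proof.
have mJ : measurable [set x : T | J (digit_prefix b n x)].
  exact: (measurable_digit_prefix n [set k | J k]).
have b0 : (0 < b)%N by exact: ltn_trans b_gt1.
have bR0 : b%:R != 0 :> R by rewrite pnatr_eq0 -lt0n.
have mJd : measurable [set x : T | J (digit_prefix b n x) && (digit b n x != 0%N)].
  under eq_set do rewrite (digit_prefix_div b_gt1 n 1) addn1 /digit.
  exact: (measurable_digit_prefix n.+1 [set k | J (k %/ b ^ 1)%N && (k %% b != 0)%N]).
rewrite (pr_cells b_gt1 n mJd) (pr_cells b_gt1 n mJ) mulr_sumr big_nat [RHS]big_nat.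
apply: eq_bigr => j /= jn; rewrite (pr_cell_split b_gt1 _ _ mJd).
have cellJ (X : set (measurableTypeR R)) m k (c : bool) :
    (k < b ^ m)%N -> (forall x : T, digit_cell b m k x -> X x <-> c) ->
    pr (X `&` digit_cell b m k) = c%:R * (b%:R ^+ m)^-1.
  move=> km Xc; rewrite -(pr_cell R b_gt1 km).
  case: c Xc => Xc; rewrite ?mul1r ?mul0r.
    by congr pr; apply/seteqP; split=> x // => [[]//|cx]; split=> //; apply/Xc.
  rewrite (_ : _ `&` _ = set0) ?/pr ?measure0//.
  by rewrite -subset0 => x [Xx /Xc [/(_ Xx)]].
rewrite (cellJ _ n j (J j))//; last first.
  by move=> x cx; have /(digit_cellP b_gt1 _ _ (cell_ge0 cx)) /= -> := cx.
rewrite big_nat (eq_bigr (fun i => (J j && (i != 0%N))%:R * (b%:R ^+ n.+1)^-1)).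
  rewrite -big_nat -mulr_suml -(prednK b0) big_nat_recl//= andbF add0r.
  under eq_bigr do rewrite andbT.
  rewrite sumr_const_nat subn0 prednK// -[_ *+ b.-1]mulr_natr -subn1 natrB//.
  by rewrite exprS; field; rewrite bR0/= expf_neq0.
move=> i ib; apply: cellJ; first exact: cell_child01.
move=> x cx; have /(digit_cellP b_gt1 _ _ (cell_ge0 cx)) px := cx.
rewrite /= (digit_prefix_div b_gt1 n 1) addn1 /digit px expn1.
by rewrite divnMDl// modnMDl divn_small// addn0 modn_small.
Qed.

Lemma pr_nonzero_digits n :
  pr [set x : T | all (fun m => digit b m x != 0%N) (iota 0 n)] =
  (1 - b%:R^-1) ^+ n.
Proof.
elim: n => [|n IHn]; first by rewrite (_ : [set x | _] = setT) ?pr_setT// eqEsubset.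
pose J k := all (fun m => (k %/ b ^ (n - m.+1)) %% b != 0)%N (iota 0 n).
have SJ (x : T) : all (fun m => digit b m x != 0%N) (iota 0 n) =
    J (digit_prefix b n x).
  apply: eq_in_all => m; rewrite mem_iota => /andP[_ mn].
  by rewrite /digit (digit_prefix_div b_gt1 m.+1 (n - m.+1)) subnKC.
rewrite exprS -IHn; under [in RHS]eq_set do rewrite SJ.
rewrite -pr_nonzero_digit; congr pr; apply/funext => x.
have -> : iota 0 n.+1 = iota 0 n ++ [:: n] by rewrite -addn1 iotaD.
by rewrite /= all_cat/= andbT SJ.
Qed.

End nonzero_digits.

Section digit_measurability.
Context (R : realType) (b : nat).
Hypothesis b_gt1 : (1 < b)%N.
Local Notation T := (measurableTypeR R).

(** If each edge reads finitely many digits, the configuration is continuous for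
    the topology generated by the digit prefixes. As there are countably many
    prefixes, the preimage of an open set is a countable union of measurable
    sets, however many edges there are. *)
Lemma measurable_digit_config (G : graph) (f : measurableTypeR R -> config G) :
  (forall e, exists n, forall x y,
    digit_prefix b n x = digit_prefix b n y -> f x e = f y e) ->
  measurable_fun setT f.
Proof.
move=> fdep.
have prefix_le n m x y : (n <= m)%N -> digit_prefix b m x = digit_prefix b m y ->
    digit_prefix b n x = digit_prefix b n y.
  by move=> nm xy; rewrite !(digit_prefix_div b_gt1 n (m - n)) subnKC// xy.
apply: (@measurability _ _ T (config G) setT f (@open {ptws edge G -> bool}))
  => // _ [U oU <-].
rewrite setTI (_ : f @^-1` U = \bigcup_n [set x : T |
    forall y : T, digit_prefix b n y = digit_prefix b n x -> U (f y)]).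
  apply: bigcup_measurable => n _.
  exact: (measurable_digit_prefix b_gt1 n
    [set k | forall y : T, digit_prefix b n y = k -> U (f y)]).
apply/seteqP; split=> [x Ufx|x [n _ /=]]; last exact.
(* The filter generated by the points that share a long prefix with [x]. *)
pose F : set_system (config G) := [set W | exists n,
  forall y, digit_prefix b n y = digit_prefix b n x -> W (f y)].
have FF : Filter F.
  split; first by exists 0%N.
    move=> V W [n Vn] [m Wm]; exists (maxn n m) => y yx; split.
      by apply: Vn; apply: prefix_le yx; rewrite leq_maxl.
    by apply: Wm; apply: prefix_le yx; rewrite leq_maxr.
  by move=> V W VW [n Vn]; exists n => y /Vn /VW.
have Fx : {ptws, F --> (f x : edge G -> bool)}.
  apply/(@pointwise_cvgP (discrete_topology (edge G)) bool F (f x)) => e.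
  apply/discrete_cvg; have [n fn] := fdep e.
  by exists n => y /fn.
have [n Un] := Fx _ (open_nbhs_nbhs (conj oU Ufx)).
by exists n.
Qed.

End digit_measurability.

(** * Layered percolation *)

Section balls.
Context (G : graph) (o : vertex G).

Fixpoint vball n : set (vertex G) :=
  if n is n'.+1
  then vball n' `|` [set v | exists2 u, vball n' u & exists e, ends e = [set u; v]]
  else [set o].

Definition crosses n (e : edge G) : Prop :=
  exists u v, [/\ vball n u, ~ vball n v & ends e = [set u; v]].

Lemma vball_le m n : (m <= n)%N -> vball m `<=` vball n.
Proof.
elim: n => [|n IHn]; first by rewrite leqn0 => /eqP ->.
by rewrite leq_eqVlt => /orP[/eqP -> //|/IHn mn x /mn]; left.
Qed.

Lemma finite_vball n : locally_finite G -> finite_set (vball n).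
Proof.
move=> lf; elim: n => [|n IHn]; first exact: finite_set1.
rewrite finite_setU; split=> //.
apply: (@sub_finite_set _ _
    (\bigcup_(u in vball n) \bigcup_(e in [set e : edge G | ends e u]) ends e)).
  move=> v [u nu [e euv]]; exists u => //; exists e; rewrite /= euv.
    by left.
  by right.
apply: bigcup_finite => // u _; apply: bigcup_finite => // e _.
by have [u' [v ->]] := endsP e; rewrite finite_setU; split; exact: finite_set1.
Qed.

(** An edge that leaves a ball has its outer endpoint in the next ball, and so
    both endpoints in all the larger ones. *)
Lemma crosses_inj m n e : crosses m e -> crosses n e -> m = n.
Proof.
wlog mn : m n / (m < n)%N => [hw|].
  by case: (ltngtP m n) => // mn cm cn; [exact: hw|exact/esym/hw].
move=> [u [v [mu nmv euv]]] [u' [v' [_ nv' euv']]]; exfalso; apply: nv'.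
have : ends e v' by rewrite euv'; right.
rewrite euv => -[->|->]; first exact: vball_le (ltnW mn) _ mu.
by apply: (vball_le mn); right; exists u => //; exists e.
Qed.

Lemma cluster_in_vball (w : config G) n :
  (forall e, crosses n e -> ~ w e) -> open_cluster w o `<=` vball n.
Proof.
move=> wn v; suff H u : Relation_Operators.clos_refl_trans _ (open_adjacent w) u v ->
    vball n u -> vball n v.
  by move=> /H; apply; exact: (vball_le (leq0n n)).
elim=> [x y [e we exy] nx|//|x y z _ xy _ yz /xy/yz//].
by apply: contrapT => ny; apply: (wn e) => //; exists x, y.
Qed.

End balls.

Section layered_percolation.
Context (R : realType) (G : graph) (o : vertex G) (b : nat).
Hypothesis b_gt1 : (1 < b)%N.
Local Notation T := (measurableTypeR R).

Definition layered_config (x : T) : config G :=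
  fun e => `[< forall n, crosses o n e -> digit b n x != 0%N >].

Lemma measurable_layered_config : measurable_fun setT layered_config.
Proof.
apply: (measurable_digit_config b_gt1) => e.
have [[n en]|ne] := pselect (exists n, crosses o n e); last first.
  by exists 0%N => x y _; apply/asboolP/asboolP => _ n en; case: ne; exists n.
exists n.+1 => x y xy; rewrite /layered_config; apply: asbool_equiv_eq.
by split=> dn m em; have := dn m em; rewrite (crosses_inj em en) /digit xy.
Qed.

Definition layered_percolation : probability (config G) R :=
  distribution (unit_lebesgue (R:=R)) (mfun_Sub (mem_set measurable_layered_config)).

Lemma layered_percolationE (A : set (config G)) :
  measurable (layered_config @^-1` A) ->
  layered_percolation A = (pr (layered_config @^-1` A))%:E.
Proof. by move=> mA; rewrite -prE. Qed.

Lemma digit_increasing_layered (A : set (config G)) :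
  increasing A -> digit_increasing b (layered_config @^-1` A).
Proof.
move=> incA x y _ _ xy Ax; apply: (incA _ _ Ax) => e.
rewrite leEbool /layered_config.
case: (asboolP (forall n, crosses o n e -> digit b n x != 0%N)) => //= xe.
rewrite lt0b; apply/asboolP => n /xe; rewrite -!lt0n => /leq_trans; exact.
Qed.

Lemma layered_percolation_fkg : FKG layered_percolation.
Proof.
move=> A B mA mB incA incB.
have mpre X : measurable X -> measurable (layered_config @^-1` X).
  by move=> mX; rewrite -[X in measurable X]setTI; exact: measurable_layered_config.
have mAB : measurable (A `&` B) by exact: measurableI.
rewrite !layered_percolationE; try exact: mpre.
rewrite -EFinM lee_fin preimage_setI.
by apply: (digit_increasing_fkg b_gt1); (try exact: mpre); exact: digit_increasing_layered.
Qed.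

Lemma layered_percolation_edge e :
  ((1 - b%:R^-1)%:E <= layered_percolation [set w : config G | w e])%E.
Proof.
have b0 : 0 <= b%:R^-1 :> R by rewrite invr_ge0.
have [[n en]|ne] := pselect (exists n, crosses o n e); last first.
  have pre : layered_config @^-1` [set w : config G | w e] = setT.
    rewrite -subTset => x _; apply/asboolP => n en.
    by case: ne; exists n.
  by rewrite layered_percolationE pre// pr_setT lee_fin gerBl.
have pre : layered_config @^-1` [set w : config G | w e] =
    [set x : T | xpredT (digit_prefix b n x) && (digit b n x != 0%N)].
  apply/seteqP; split=> x /=; first by move=> /asboolP; exact.
  by move=> xn; apply/asboolP => m em; rewrite (crosses_inj em en).
have mpre : measurable [set x : T | xpredT (digit_prefix b n x) && (digit b n x != 0%N)].
  exact: (measurable_digit_prefix b_gt1 n.+1 [set k | k %% b != 0]%N).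
rewrite layered_percolationE pre// lee_fin.
have -> := pr_nonzero_digit R b_gt1 n xpredT.
by rewrite (_ : [set x : T | _] = setT) ?pr_setT ?mulr1// -subTset.
Qed.

(** A vanishing digit of index [m] closes all the edges that leave the ball of
    radius [m], and confines the cluster of [o] to it. *)
Lemma layered_percolation_connect n v : ~ vball o n v ->
  (layered_percolation [set w | open_cluster w o v] <=
    ((1 - b%:R^-1) ^+ n)%:E)%E.
Proof.
move=> nv; rewrite -(pr_nonzero_digits R b_gt1) -prE.
  (* Comparison as an outer measure, which applies to any connection event. *)
  apply: le_outer_measure => x [xv x01]; split=> //.
  apply/allP => m; rewrite mem_iota => /andP[_ mn]; apply/negP => /eqP xm.
  apply: nv; apply: (vball_le (ltnW mn)); apply: (cluster_in_vball _ xv).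
  by move=> e em /asboolP /(_ _ em); rewrite xm.
pose P (k : nat) := all (fun m => (k %/ b ^ (n - m.+1)) %% b != 0)%N (iota 0 n).
rewrite (_ : [set x | _] = [set x : T | P (digit_prefix b n x)]).
  exact: (measurable_digit_prefix b_gt1 n [set k | P k]).
apply/funext => x /=; congr is_true; apply: eq_in_all => m.
rewrite mem_iota => /andP[_ mn].
by rewrite /digit (digit_prefix_div b_gt1 m.+1 (n - m.+1)) subnKC.
Qed.

Lemma layered_percolation_decay : locally_finite G ->
  infinite_set [set: vertex G] -> connectivity_decay layered_percolation.
Proof.
move=> lf infV; apply/eqP; rewrite eq_le; apply/andP; split; last first.
  by apply: le_ereal_inf_tmp => _ [u [v ->]]; exact: measure_ge0.
apply/lee_addgt0Pr => e e0; rewrite add0e.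
pose q : R := 1 - b%:R^-1.
have b0 : 0 < b%:R :> R by rewrite ltr0n (ltn_trans _ b_gt1).
have q0 : 0 <= q by rewrite subr_ge0 invf_le1// ler1n ltnW.
have q1 : `|q| < 1 by rewrite ger0_norm// gtrBl invr_gt0.
have /cvgr0Pnorm_lt cvg_q := cvg_expr q1.
have [n _ qN] := cvg_q e e0; have qn := qN n (leqnn n); rewrite /= in qn.
rewrite ger0_norm ?exprn_ge0// in qn.
have [v nv] : exists v, ~ vball o n v.
  apply/existsNP => all_v; apply: infV; apply: sub_finite_set (finite_vball o n lf).
  by move=> v _; exact: all_v.
apply: le_trans (ereal_inf_lbound _) _; first by exists o, v.
apply: le_trans (layered_percolation_connect nv) _.
by rewrite lee_fin ltW.
Qed.

End layered_percolation.

Local Open Scope ereal_scope.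

Theorem proposition4p4 (R : realType) (G : graph)
    (G_locally_finite : locally_finite G)
    (G_connected : connected_graph G)
    (G_infinite : infinite_set [set: vertex G])
    (p : R) (p_lt1 : (p < 1)%R) :
  exists P : probability (config G) R,
    [/\ forall e : edge G, p%:E < P [set w : config G | w e],
        FKG P &
        connectivity_decay P].
Proof.
have [root _] : [set: vertex G] !=set0.
  by apply/set0P/negP => /eqP V0; apply: G_infinite; rewrite V0.
pose b := (Num.truncn (1 - p)^-1).+2.
have b_gt1 : (1 < b)%N by [].
exists (layered_percolation R root b_gt1); split.
- move=> e; apply: lt_le_trans (layered_percolation_edge R root b_gt1 e).
  rewrite lte_fin ltrBrDl -ltrBrDr invf_plt ?posrE ?subr_gt0//.
  by rewrite (lt_trans (truncnS_gt _))// ltr_nat.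
- exact: layered_percolation_fkg.
- exact: layered_percolation_decay.
Qed.
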